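(* Let $p$ be a prime, let $k$ be a commutative ring of characteristic $p$ and let $A$ be a commutative $k$-algebra. Then, for every integer $n>1$ which is not a power of $p$, one has $\operatorname{IDer}_k(A;n-1)=\operatorname{IDer}_k(A;n)$.
   Context: For a commutative ring $k$, a commutative $k$-algebra $A$ and an integer $m\geq 1$ (or $m=\infty$), a Hasse-Schmidt derivation of $A$ over $k$ of length $m$ is a sequence $D=(D_0,D_1,\ldots,D_m)$ (or $D=(D_0,D_1,\ldots)$ if $m=\infty$) of $k$-linear maps $D_n:A\to A$ with $D_0=\mathrm{Id}_A$ and $D_n(xy)=\sum_{i+j=n}D_i(x)D_j(y)$ for all $x,y\in A$ and all $n$. The set of these is $\operatorname{HS}_k(A;m)$. The component $D_1$ is always a $k$-derivation of $A$. $\operatorname{IDer}_k(A;m)$ denotes the set of $m$-integrable $k$-derivations of $A$, i.e. those $\delta\in\operatorname{Der}_k(A)$ for which there is $D\in \operatorname{HS}_k(A;m)$ with $D_1=\delta$. *)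

(* Defs.v *)
From mathcomp Require Import all_boot all_algebra.
From mathcomp Require Import boolp classical_sets.

Set Implicit Arguments.
Unset Strict Implicit.
Unset Printing Implicit Defensive.

Import GRing.Theory.

Local Open Scope ring_scope.
Local Open Scope classical_set_scope.

(* A commutative k-algebra is given by its structure morphism rho : k -> A, so
   that the action of c : k on x : A is rho c * x. MathComp's comAlgType is not
   used because it excludes the zero algebra. *)
Section HasseSchmidt.

Variables (k : comNzRingType) (A : comPzRingType) (rho : {rmorphism k -> A}).

Definition klinear (f : A -> A) : Prop :=
  {morph f : x y / x + y} /\ forall c : k, {morph f : x / rho c * x}.

Definition Der : set (A -> A) :=
  [set d | klinear d /\ forall x y, d (x * y) = d x * y + x * d y].

(* D i is the component D_i; 'I_m.+1 is the index set {0, ..., m}. *)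
Definition HS (m : nat) : set ('I_m.+1 -> A -> A) :=
  [set D | [/\ forall n, klinear (D n),
               D ord0 = id &
               forall (n : 'I_m.+1) (x y : A),
                 D n (x * y) =
                   \sum_(i < m.+1) \sum_(j < m.+1 | (i + j == n)%N)
                     D i x * D j y]].

Arguments HS m D : clear implicits.

(* Only meaningful for m >= 1: otherwise inord 1 is not the index 1. *)
Definition IDer (m : nat) : set (A -> A) :=
  [set d | Der d /\ exists2 D, HS m D & D (inord 1) = d].

End HasseSchmidt.

Arguments HS {k A} rho m D.

(* Main.v *)
Require Import Defs.
From mathcomp Require Import all_boot all_algebra.
From mathcomp Require Import boolp classical_sets zify.

Set Implicit Arguments.
Unset Strict Implicit.
Unset Printing Implicit Defensive.

Import GRing.Theory.

(** Write a Hasse-Schmidt derivation D of length n - 1 as the multiplicative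
    series D(t) = sum_i D_i t^i modulo t^n. With an arbitrary k-linear D_n, the
    obstruction to extending it is the defect
      f(x, y) = D_n(xy) - sum_(i + j = n) D_i(x) D_j(y),
    and the defects of two series add when the series are composed
    ([defectD]). So it suffices to find a series M(t) with M_1 = 0 and with
    defect - f at t^n: the composite D(t) o M(t) then has the same first
    component as D and defect zero.

    Put n = p^e q with q > 1 prime to p, and a = p^e, r = q - 1. The series
    D(s + u) in two variables has defect binomial(n, a) f at the monomial
    s^a u^(n - a) ([defect_taylor]), and binomial(n, a) is congruent to q modulo
    p, hence invertible ([bin_prime_power_mod]). A Birkhoff-type factorization
    D(s + u) = N(s, u) o P(s, u), where N involves, besides 1, only monomials
    s^i u^j with j < r i and P only monomials with j >= r i, exists because
    both sets of exponents are closed under addition; each factor is again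
    multiplicative in total degree < n ([factorization_defect]). At (a, r a),
    which lies on the ray j = r i, the factor N has no defect, so P carries
    the whole defect binomial(n, a) f. As the ray is an extreme face of the
    cone j >= r i, the components of P on it form a series L(t) in one
    variable, multiplicative modulo t^a, whose defect at t^a is
    binomial(n, a) f ([ray_curve]).

    Finally M(t) = L(c t^q), for an integer c, has M_1 = 0 because q > 1, is
    multiplicative below t^n, and has defect c^a binomial(n, a) f at t^n;
    since c^a = c modulo p, the integer c can be chosen to make this - f. *)

(** * Sums over the decompositions of a bidegree *)

Section Convolution.

Local Open Scope ring_scope.

Variable V : nmodType.

Definition conv (v : nat * nat) (g : nat * nat -> nat * nat -> V) : V :=
  \sum_(i < v.1.+1) \sum_(j < v.2.+1) g (i : nat, j : nat) (v.1 - i, v.2 - j)%N.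

Implicit Types (v : nat * nat) (g h : nat * nat -> nat * nat -> V).

Lemma eq_conv v g h :
    (forall a b, (a.1 + b.1 = v.1)%N -> (a.2 + b.2 = v.2)%N -> g a b = h a b) ->
  conv v g = conv v h.
Proof.
move=> gh; apply: eq_bigr => i _; apply: eq_bigr => j _.
by apply: gh; rewrite /= subnKC // -ltnS.
Qed.

Lemma conv_eq0 v g :
    (forall a b, (a.1 + b.1 = v.1)%N -> (a.2 + b.2 = v.2)%N -> g a b = 0) ->
  conv v g = 0.
Proof.
move=> g0; rewrite (eq_conv (h := fun _ _ => 0)) //.
by apply: big1 => i _; apply: big1.
Qed.

Lemma convD v g h : conv v (fun a b => g a b + h a b) = conv v g + conv v h.
Proof.
rewrite -big_split; apply: eq_bigr => i _; exact: big_split.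
Qed.

Lemma sum_triangle n (f : nat -> nat -> nat -> V) :
  \sum_(k < n.+1) \sum_(i < k.+1) f i (k - i)%N (n - k)%N =
  \sum_(i < n.+1) \sum_(j < (n - i).+1) f i j (n - i - j)%N.
Proof.
transitivity (\sum_(k < n.+1) \sum_(i < n.+1 | (i <= k)%N)
    f i (k - i)%N (n - k)%N).
  apply: eq_bigr => k _.
  by rewrite (big_ord_widen n.+1 (fun i => f i (k - i)%N (n - k)%N)).
rewrite (exchange_big_dep predT) //=; apply: eq_bigr => i _.
rewrite -(big_geq_mkord i n.+1 (fun _ => true) (fun k => f i (k - i)%N (n - k)%N)).
rewrite -{1}[nat_of_ord i]add0n big_addn big_mkord subSn -1?ltnS //.
apply: eq_bigr => j _; rewrite addnK; congr f; lia.
Qed.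

Lemma convC v g : conv v g = conv v (fun a b => g b a).
Proof.
rewrite /conv (reindex_inj rev_ord_inj); apply: eq_bigr => i _.
rewrite (reindex_inj rev_ord_inj); apply: eq_bigr => j _ /=.
by rewrite !subSS !subKn // -ltnS.
Qed.

Lemma convA v (f : nat * nat -> nat * nat -> nat * nat -> V) :
  conv v (fun a b => conv a (fun a1 a2 => f a1 a2 b)) =
  conv v (fun a b => conv b (fun b1 b2 => f a b1 b2)).
Proof.
rewrite /conv /=.
transitivity (\sum_(k < v.1.+1) \sum_(i < k.+1)
   \sum_(l < v.2.+1) \sum_(j < l.+1)
     f (i : nat, j : nat) (k - i, l - j)%N (v.1 - k, v.2 - l)%N).
  by apply: eq_bigr => k _; rewrite exchange_big.
rewrite (@sum_triangle v.1 (fun i i' i'' => \sum_(l < v.2.+1) \sum_(j < l.+1)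
     f (i : nat, j : nat) (i', l - j)%N (i'', v.2 - l)%N)).
apply: eq_bigr => i _.
rewrite [RHS]exchange_big; apply: eq_bigr => i' _.
exact: (@sum_triangle v.2 (fun j j' j'' =>
  f (i : nat, j) (i' : nat, j') (v.1 - i - i', j'')%N)).
Qed.

(** The interchange law behind the multiplicativity of a composite: the
    decompositions of v into four parts can be grouped in two ways. *)
Lemma convACA v (f : nat * nat -> nat * nat -> nat * nat -> nat * nat -> V) :
  conv v (fun a b => conv b (fun b1 b2 => conv a (fun a1 a2 => f a1 a2 b1 b2))) =
  conv v (fun a b => conv a (fun a1 b1 => conv b (fun a2 b2 => f a1 a2 b1 b2))).
Proof.
rewrite -(convA v (fun a b1 b2 => conv a (fun a1 a2 => f a1 a2 b1 b2))).
rewrite (convA v (fun a1 b1 b => conv b (fun a2 b2 => f a1 a2 b1 b2))).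
transitivity (conv v (fun c b2 => conv c (fun a1 d =>
    conv d (fun b1 a2 => f a1 a2 b1 b2)))).
  apply: eq_conv => c b2 _ _.
  rewrite (convA c (fun a1 a2 b1 => f a1 a2 b1 b2)).
  by apply: eq_conv => a1 d _ _; rewrite convC.
rewrite (convA v (fun a1 d b2 => conv d (fun b1 a2 => f a1 a2 b1 b2))).
by apply: eq_conv => a1 e _ _; rewrite convA.
Qed.

Lemma conv_left v g :
    (forall a b, (a.1 + b.1 = v.1)%N -> (a.2 + b.2 = v.2)%N -> b <> v ->
       g a b = 0) ->
  conv v g = g (0, 0)%N v.
Proof.
case: v => m l g0.
rewrite /conv big_ord_recl /= big_ord_recl /= !subn0.
rewrite big1 ?addr0 => [|j _]; last first.
  apply: g0 => /=; rewrite /bump /=; [lia | have := ltn_ord j; lia |].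
  by case; have := ltn_ord j; lia.
rewrite big1 ?addr0 // => i _; apply: big1 => j _.
apply: g0 => /=; rewrite /bump /=; have := ltn_ord i; have := ltn_ord j; try lia.
by move=> ? ? []; lia.
Qed.

Lemma conv_right v g :
    (forall a b, (a.1 + b.1 = v.1)%N -> (a.2 + b.2 = v.2)%N -> a <> v ->
       g a b = 0) ->
  conv v g = g v (0, 0)%N.
Proof.
move=> g0; rewrite convC conv_left // => a b ab1 ab2.
by apply: g0; rewrite addnC.
Qed.

Lemma conv_ends v g : v != (0, 0)%N ->
  conv v g = g (0, 0)%N v + g v (0, 0)%N
    + conv v (fun a b => if (a == (0, 0)%N) || (b == (0, 0)%N) then 0 else g a b).
Proof.
move=> v0.
have -> : g (0, 0)%N v = conv v (fun a b => if a == (0, 0)%N then g a b else 0).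
  rewrite conv_left // => -[a1 a2] [b1 b2] /= ab1 ab2 bv.
  case: eqP => // -[a10 a20]; case: bv.
  by rewrite [v]surjective_pairing -ab1 -ab2 a10 a20.
have -> : g v (0, 0)%N = conv v (fun a b => if b == (0, 0)%N then g a b else 0).
  rewrite conv_right // => -[a1 a2] [b1 b2] /= ab1 ab2 av.
  case: eqP => // -[b10 b20]; case: av.
  by rewrite [v]surjective_pairing -ab1 -ab2 b10 b20 !addn0.
rewrite -!convD; apply: eq_conv => -[a1 a2] [b1 b2] /= ab1 ab2.
case: eqP => [[a10 a20]|_]; case: eqP => [[b10 b20]|_];
  rewrite /= ?addr0 ?add0r //.
by case/negP: v0; rewrite [v]surjective_pairing -ab1 -ab2 a10 a20 b10 b20.
Qed.

End Convolution.

(** * Families of operators in two variables and their defects *)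

Section Families.

Local Open Scope ring_scope.

Variables (k : comNzRingType) (A : comPzRingType) (rho : {rmorphism k -> A}).

Implicit Types (f : A -> A) (F H G N P : nat * nat -> A -> A) (v : nat * nat).

Lemma klinear0 : klinear rho (fun _ => 0).
Proof. by split=> [x y|c x]; rewrite ?addr0 ?mulr0. Qed.

Lemma klinear_id : klinear rho id.
Proof. by []. Qed.

Lemma klinearD f g : klinear rho f -> klinear rho g ->
  klinear rho (fun x => f x + g x).
Proof.
move=> [fD fZ] [gD gZ]; split=> [x y|c x]; first by rewrite fD gD addrACA.
by rewrite fZ gZ mulrDr.
Qed.

Lemma klinearZ b f : klinear rho f -> klinear rho (fun x => b * f x).
Proof.
move=> [fD fZ]; split=> [x y|c x]; first by rewrite fD mulrDr.
by rewrite fZ mulrCA.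
Qed.

Lemma klinear_comp f g : klinear rho f -> klinear rho g ->
  klinear rho (fun x => f (g x)).
Proof.
by move=> [fD fZ] [gD gZ]; split=> [x y|c x]; rewrite ?gD ?fD ?gZ ?fZ.
Qed.

Lemma klinear_conv v (g : nat * nat -> nat * nat -> A -> A) :
    (forall a b, klinear rho (g a b)) ->
  klinear rho (fun x => conv v (fun a b => g a b x)).
Proof.
move=> gl; have aux m (s : 'I_m -> A -> A) : (forall i, klinear rho (s i)) ->
    klinear rho (fun x => \sum_i s i x).
  move=> sl; split=> [x y|c x].
    by rewrite -big_split; apply: eq_bigr => i _; have [-> _] := sl i.
  by rewrite big_distrr; apply: eq_bigr => i _; have [_ ->] := sl i.
by apply: (aux _ (fun i x => \sum_j g _ _ x)) => i; apply: (aux _ (fun j => g _ _)).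
Qed.

Lemma klinear_at0 f : klinear rho f -> f 0 = 0.
Proof. by move=> [_ fZ]; have := fZ 0 0; rewrite rmorph0 !mul0r. Qed.

Lemma klinear_conv_out f v g : klinear rho f ->
  f (conv v g) = conv v (fun a b => f (g a b)).
Proof.
move=> fl; have [fD _] := fl.
rewrite /conv (big_morph f fD (klinear_at0 fl)); apply: eq_bigr => i _.
exact: (big_morph f fD (klinear_at0 fl)).
Qed.

(** The coefficient at s^v.1 u^v.2 of F(xy) - F(x) F(y), for the operator
    F = sum_v F_v s^v.1 u^v.2. *)
Definition defect F v x y := F v (x * y) - conv v (fun a b => F a x * F b y).

Definition comp_family F H v x := conv v (fun a b => F a (H b x)).

(** From F(H(xy)) - F(H(x)) F(H(y)) = F(H(xy) - H(x) H(y)) + F(H(x) H(y)) -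
    F(H(x)) F(H(y)), with F and H extended linearly to power series. *)
Lemma defect_comp F H v x y : (forall a, klinear rho (F a)) ->
  defect (comp_family F H) v x y =
    conv v (fun a b => F a (defect H b x y))
    + conv v (fun a b => conv b (fun b1 b2 => defect F a (H b1 x) (H b2 y))).
Proof.
move=> Fl; pose f a1 a2 b1 b2 := F a1 (H b1 x) * F a2 (H b2 y).
rewrite {1}/defect.
have -> : conv v (fun a b => comp_family F H a x * comp_family F H b y) =
    conv v (fun a b => conv b (fun b1 b2 => conv a (fun a1 a2 => f a1 a2 b1 b2))).
  rewrite convACA; apply: eq_conv => a b _ _; rewrite /comp_family /conv big_distrl.
  apply: eq_bigr => i _; rewrite big_distrl; apply: eq_bigr => j _.
  rewrite big_distrr; apply: eq_bigr => i' _; rewrite big_distrr.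
  exact: eq_bigr.
apply/eqP; rewrite subr_eq {1}/comp_family -!convD; apply/eqP; apply: eq_conv => a b _ _.
rewrite -addrA -convD; have [FD _] := Fl a.
rewrite -[in LHS](subrK (conv b (fun b1 b2 => H b1 x * H b2 y)) (H b (x * y))) FD.
rewrite (klinear_conv_out _ _ (Fl a)); congr (_ + _).
by apply: eq_conv => b1 b2 _ _; rewrite subrK.
Qed.

Definition leibniz F d :=
  forall v, (v.1 + v.2 < d)%N -> forall x y, defect F v x y = 0.

Lemma degree_part (a b v : nat * nat) :
    (a.1 + b.1 = v.1)%N -> (a.2 + b.2 = v.2)%N -> a <> v ->
  (a.1 + a.2 < v.1 + v.2)%N.
Proof.
case: a b v => [a1 a2] [b1 b2] [v1 v2] /= ab1 ab2 av.
by rewrite ltnNge; apply/negP => ge; case: av; congr pair; lia.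
Qed.

(** In the formula for the defect of a composite, multiplicativity in lower
    degree leaves only the terms where one factor contributes its component
    at v and the other one the identity. *)
Lemma defectD F H v x y :
    (forall a, klinear rho (F a)) -> F (0, 0)%N = id -> H (0, 0)%N = id ->
    leibniz F (v.1 + v.2) -> leibniz H (v.1 + v.2) ->
  defect (comp_family F H) v x y = defect F v x y + defect H v x y.
Proof.
move=> Fl F0 H0 LF LH; rewrite defect_comp // addrC; congr (_ + _).
  rewrite conv_right => [|a b ab1 ab2 av].
    by rewrite /conv !big_ord1 /= H0.
  apply: conv_eq0 => b1 b2 _ _; apply: LF.
  exact: degree_part ab1 ab2 av.
rewrite conv_left => [|a b ab1 ab2 bv]; first by rewrite F0.
rewrite LH ?(klinear_at0 (Fl a)) //.
by apply: (@degree_part b a) => //; rewrite addnC.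
Qed.

Lemma comp_eval F H v x : v != (0, 0)%N ->
    F (0, 0)%N = id -> H (0, 0)%N = id ->
  comp_family F H v x = H v x + F v x
    + conv v (fun a b =>
        if (a == (0, 0)%N) || (b == (0, 0)%N) then 0 else F a (H b x)).
Proof. by move=> v0 F0 H0; rewrite /comp_family conv_ends // F0 H0. Qed.

(** * Birkhoff factorization along a half-plane *)

Section Factorization.

Variable neg : nat * nat -> bool.

(** Degree by degree, the equation at v determines N_v + P_v from components of
    lower degree, and this sum is assigned entirely to N or to P according to
    whether v is in neg. *)
Lemma factorization G d :
    (forall v, klinear rho (G v)) -> G (0, 0)%N = id -> neg (0, 0)%N = false ->
  exists N P,
    [/\ forall v, klinear rho (N v) /\ klinear rho (P v),
        N (0, 0)%N = id /\ P (0, 0)%N = id,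
        forall v, v != (0, 0)%N -> ~~ neg v -> N v = fun _ => 0,
        forall v, neg v -> P v = fun _ => 0 &
        forall v, (v.1 + v.2 <= d)%N -> comp_family N P v =1 G v].
Proof.
move=> Gl G0 neg0; elim: d => [|d [N [P [NPl [N0 P0] Npos Pneg NPG]]]].
  pose I v : A -> A := if v == (0, 0)%N then id else fun _ => 0.
  exists I, I; split=> //.
  - move=> v; rewrite /I.
    by case: eqP => _; split; apply: klinear0 || apply: klinear_id.
  - by move=> v /negPf v0 _; rewrite /I v0.
  - by move=> v; rewrite /I; case: eqP => // ->; rewrite neg0.
  move=> [[|//] [|//]] _ x.
  by rewrite /comp_family /conv !big_ord1 G0 /I.
pose mid v x := conv v (fun a b =>
  if (a == (0, 0)%N) || (b == (0, 0)%N) then 0 else N a (P b x)).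
(* The coefficient is written rho (- 1) so that X v is visibly k-linear. *)
pose X v x := G v x + rho (- 1) * mid v x.
have Xl v : klinear rho (X v).
  apply: klinearD => //; apply: klinearZ; apply: klinear_conv => a b.
  case: (_ || _) => /=; first exact: klinear0.
  by apply: klinear_comp; [case: (NPl a) | case: (NPl b)].
pose N' v := if (v.1 + v.2 == d.+1)%N then if neg v then X v else fun _ => 0
             else N v.
pose P' v := if (v.1 + v.2 == d.+1)%N then if neg v then fun _ => 0 else X v
             else P v.
have small v : (v.1 + v.2 <= d)%N -> N' v = N v /\ P' v = P v.
  by rewrite /N' /P' -ltnS ltn_neqAle => /andP[/negPf-> _].
exists N', P'; split.
- move=> v; rewrite /N' /P'; case: eqP => _; last exact: NPl.
  by case: (neg v); split=> //; apply: klinear0.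
- by have [-> ->] := small (0, 0)%N isT.
- by move=> v v0 nv; rewrite /N' (negPf nv); case: eqP => // _; apply: Npos.
- by move=> v nv; rewrite /P' nv; case: eqP => // _; apply: Pneg.
move=> v; rewrite leq_eqVlt => /orP[/eqP vd x|]; last first.
  rewrite ltnS => vd x; rewrite -NPG //; apply: eq_conv => a b ab1 ab2.
  by have [-> _] := small a ltac:(lia); have [_ ->] := small b ltac:(lia).
have v0 : v != (0, 0)%N by apply/eqP => v0; rewrite v0 in vd.
rewrite comp_eval //; try by have [] := small (0, 0)%N isT; rewrite ?N0 ?P0.
have -> : conv v (fun a b =>
    if (a == (0, 0)%N) || (b == (0, 0)%N) then 0 else N' a (P' b x)) = mid v x.
  apply: eq_conv => a b ab1 ab2.
  case: eqP => //= a0; case: eqP => //= b0.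
  have sa : (a.1 + a.2 <= d)%N.
    by case: a b a0 b0 ab1 ab2 => [[|?] [|?]] // [[|?] [|?]] //=; lia.
  have sb : (b.1 + b.2 <= d)%N.
    by case: a b a0 b0 ab1 ab2 {sa} => [[|?] [|?]] // [[|?] [|?]] //=; lia.
  by have [-> _] := small a sa; have [_ ->] := small b sb.
rewrite /N' /P' vd eqxx; case: (neg v); rewrite ?add0r ?addr0;
  by rewrite /X rmorphN1 mulN1r subrK.
Qed.

Hypothesis negD : forall a b, neg a -> neg b -> neg (a.1 + b.1, a.2 + b.2)%N.
Hypothesis posD : forall a b, ~~ neg a -> ~~ neg b ->
  ~~ neg (a.1 + b.1, a.2 + b.2)%N.

(** As neg is closed under addition, v is not a sum of two bidegrees of the
    support of N, which consists of (0, 0) and elements of neg. *)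
Lemma defect_negative N v x y :
    (forall u, u != (0, 0)%N -> ~~ neg u -> N u = fun _ => 0) ->
    v != (0, 0)%N -> ~~ neg v ->
  defect N v x y = 0.
Proof.
move=> Npos v0 nv; rewrite /defect Npos // conv_eq0 ?subr0 // => a b ab1 ab2.
have [na|na] := boolP (neg a); last first.
  have [a0|a0] := eqVneq a (0, 0)%N; last by rewrite (Npos a) // mul0r.
  have -> : b = v by rewrite [v]surjective_pairing -ab1 -ab2 a0; case: (b).
  by rewrite (Npos v) // mulr0.
have [nb|nb] := boolP (neg b); last first.
  have [b0|b0] := eqVneq b (0, 0)%N; last by rewrite (Npos b) // mulr0.
  have -> : a = v.
    by rewrite [v]surjective_pairing -ab1 -ab2 b0 !addn0; case: (a).
  by rewrite (Npos v) // mul0r.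
by case/negP: nv; rewrite [v]surjective_pairing -ab1 -ab2 negD.
Qed.

Lemma defect_nonnegative P v x y :
    (forall u, neg u -> P u = fun _ => 0) -> neg v -> defect P v x y = 0.
Proof.
move=> Pneg nv; rewrite /defect Pneg // conv_eq0 ?subr0 // => a b ab1 ab2.
have [na|na] := boolP (neg a); first by rewrite Pneg // mul0r.
have [nb|nb] := boolP (neg b); first by rewrite [P b]Pneg // mulr0.
have := posD na nb; rewrite ab1 ab2 -surjective_pairing.
by rewrite nv.
Qed.

Lemma eq_defect F H d v x y : (forall v, (v.1 + v.2 <= d)%N -> F v =1 H v) ->
  (v.1 + v.2 <= d)%N -> defect F v x y = defect H v x y.
Proof.
move=> FH vd; rewrite /defect FH //; congr (_ - _); apply: eq_conv => a b ab1 ab2.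
by rewrite !FH //; lia.
Qed.

(** At each bidegree one of the factors N and P has no defect, for support
    reasons, so the other one inherits the whole defect of G. In lower degree
    this gives, by induction, the multiplicativity of both factors. *)
Lemma factorization_defect G d : 
    (forall v, klinear rho (G v)) -> G (0, 0)%N = id -> neg (0, 0)%N = false ->
    leibniz G d ->
  exists P,
    [/\ forall v, klinear rho (P v),
        P (0, 0)%N = id,
        forall v, neg v -> P v = fun _ => 0,
        leibniz P d &
        forall v x y, ~~ neg v -> (v.1 + v.2 = d)%N ->
          defect P v x y = defect G v x y].
Proof.
move=> Gl G0 neg0 LG.
have [N [P [NPl [N0 P0] Npos Pneg NPG]]] := factorization d Gl G0 neg0.
have Nl v : klinear rho (N v) by case: (NPl v).
have NPd v x y : (v.1 + v.2 <= d)%N -> leibniz N (v.1 + v.2) ->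
    leibniz P (v.1 + v.2) -> defect N v x y + defect P v x y = defect G v x y.
  by move=> vd LN LP; rewrite -(eq_defect _ _ NPG) // defectD.
have def0 F : F (0, 0)%N = id -> forall x y, defect F (0, 0)%N x y = 0.
  by move=> F0 x y; rewrite /defect /conv !big_ord1 F0 subrr.
have [LN LP] : leibniz N d /\ leibniz P d.
  suff: forall m, (m <= d)%N -> leibniz N m /\ leibniz P m by apply.
  elim=> [|m IHm] md; first by split.
  have [LN LP] := IHm (ltnW md).
  suff aux v x y : (v.1 + v.2 < m.+1)%N -> defect N v x y = 0 /\ defect P v x y = 0.
    by split=> v vm x y; case: (aux v x y vm).
  rewrite ltnS leq_eqVlt => /orP[/eqP vm|vm]; last by rewrite LN ?LP.
  have [->|v0] := eqVneq v (0, 0)%N; first by rewrite !def0.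
  have := NPd v x y; rewrite vm => /(_ (ltnW md) LN LP).
  rewrite (LG v) ?vm // => NP0.
  have [nv|nv] := boolP (neg v).
    by move: NP0; rewrite (defect_nonnegative _ _ Pneg nv) addr0.
  by move: NP0; rewrite (defect_negative _ _ Npos v0 nv) add0r.
exists P; split=> // [v|v x y nv vd]; first by case: (NPl v).
have [->|v0] := eqVneq v (0, 0)%N; first by rewrite !def0.
by rewrite -NPd ?vd // (defect_negative _ _ Npos v0 nv) add0r.
Qed.

End Factorization.
End Families.

(** * Operations on one-variable series *)

Section Curves.

Local Open Scope ring_scope.

Variables (k : comNzRingType) (A : comPzRingType) (rho : {rmorphism k -> A}).

Implicit Types D E F L : nat -> A -> A.

Definition curve_defect F n x y :=
  F n (x * y) - \sum_(i < n.+1) F i x * F (n - i)%N y.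

(** A series in s alone, seen as a series in s and u, so that the
    one-variable statement on defects is a case of the two-variable one. *)
Definition on_axis F (v : nat * nat) : A -> A :=
  if v.2 == 0%N then F v.1 else fun _ => 0.

Lemma defect_on_axis F v x y :
  defect (on_axis F) v x y = if v.2 == 0%N then curve_defect F v.1 x y else 0.
Proof.
case: v => n [|j]; rewrite /defect /=.
  by congr (_ - _); apply: eq_bigr => i _; rewrite big_ord1.
rewrite /on_axis /= conv_eq0 ?subr0 // => -[a1 a2] [b1 b2] /= _ abj.
case: a2 abj => [|a2] abj; last by rewrite mul0r.
by case: b2 abj => [//|b2] _; rewrite mulr0.
Qed.

Lemma curve_defect_comp F H n x y :
    (forall i, klinear rho (F i)) -> F 0%N = id -> H 0%N = id ->
    (forall m, (m < n)%N -> forall x y, curve_defect F m x y = 0) ->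
    (forall m, (m < n)%N -> forall x y, curve_defect H m x y = 0) ->
  curve_defect (fun m z => \sum_(i < m.+1) F i (H (m - i)%N z)) n x y =
    curve_defect F n x y + curve_defect H n x y.
Proof.
move=> Fl F0 H0 LF LH.
have lz E : (forall m, (m < n)%N -> forall x y, curve_defect E m x y = 0) ->
    leibniz (on_axis E) n.
  move=> LE v vn z t; rewrite defect_on_axis; case: eqP => // _; apply: LE.
  exact: leq_ltn_trans (leq_addr _ _) vn.
have := @defectD _ _ rho (on_axis F) (on_axis H) (n, 0)%N x y.
rewrite !defect_on_axis /= addn0 => <-; rewrite ?F0 ?H0 //; try exact: lz.
- rewrite /defect /curve_defect; congr (_ - _).
    by apply: eq_bigr => i _; rewrite big_ord1.
  apply: eq_bigr => i _; rewrite big_ord1; congr (_ * _).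
    by apply: eq_bigr => j _; rewrite big_ord1.
  by apply: eq_bigr => j _; rewrite big_ord1.
- by move=> v; rewrite /on_axis; case: eqP => _; [exact: Fl | exact: klinear0].
Qed.

(** The coefficients of D(s + u). *)
Definition taylor D (v : nat * nat) (x : A) : A :=
  'C(v.1 + v.2, v.1)%:R * D (v.1 + v.2)%N x.

(** Grouping by m = a + b reduces this to Vandermonde's convolution. *)
Lemma sum_binomials i j (h : nat -> A) :
  \sum_(a < i.+1) \sum_(b < j.+1)
    ('C(a + b, a) * 'C((i - a) + (j - b), i - a))%:R * h (a + b)%N =
  'C(i + j, i)%:R * \sum_(m < (i + j).+1) h m.
Proof.
transitivity (\sum_(a < i.+1) \sum_(m < (i + j).+1)
    ('C(m, a) * 'C(i + j - m, i - a))%:R * h m).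
  apply: eq_bigr => a _; have ai : (a <= i)%N by rewrite -ltnS.
  (* psi vanishes outside [a, a + j], by its first or its second binomial. *)
  pose psi m := ('C(m, a) * 'C(i + j - m, i - a))%:R * h m.
  have low : \sum_(0 <= m < a) psi m = 0.
    rewrite big_nat big1 // => m /andP[_ ma].
    by rewrite /psi bin_small // mul0n mul0r.
  have high : \sum_((a + j).+1 <= m < (i + j).+1) psi m = 0.
    rewrite big_nat big1 // => m /andP[am mij].
    by rewrite /psi ['C(i + j - m, _)]bin_small ?muln0 ?mul0r //; lia.
  rewrite -[RHS](big_mkord xpredT psi) (@big_cat_nat _ _ _ a) //=; last by lia.
  rewrite low add0r (@big_cat_nat _ _ _ (a + j).+1) //=; try lia.
  rewrite high addr0.
  have := big_addn 0 (a + j).+1 a xpredT psi; rewrite add0n => ->; rewrite big_mkord.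
  have -> : ((a + j).+1 - a = j.+1)%N by lia.
  apply: eq_bigr => b _; rewrite /psi [(b + a)%N]addnC.
  by have -> : (i + j - (a + b) = i - a + (j - b))%N by have := ltn_ord b; lia.
rewrite exchange_big mulr_sumr; apply: eq_bigr => m _ /=.
rewrite -mulr_suml -natr_sum binomial.Vandermonde.
by congr ('C(_, _)%:R * _); have := ltn_ord m; lia.
Qed.

Lemma defect_taylor D v x y :
  defect (taylor D) v x y =
    'C(v.1 + v.2, v.1)%:R * curve_defect D (v.1 + v.2) x y.
Proof.
rewrite /defect /curve_defect mulrBr; congr (_ - _).
rewrite -(sum_binomials _ _ (fun m => D m x * D (v.1 + v.2 - m)%N y)).
apply: eq_bigr => a _; apply: eq_bigr => b _.
rewrite /taylor /= mulrACA -natrM; congr (_ * (_ * D _ y)).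
by have := ltn_ord a; have := ltn_ord b; lia.
Qed.

(** A point of the ray j = r i is a sum of two points with j >= r i only if
    both lie on the ray: the ray is a face of the cone supporting P. *)
Lemma curve_defect_ray r P m x y :
    (forall v, (v.2 < r * v.1)%N -> P v = fun _ : A => 0 : A) ->
  curve_defect (fun i => P (i, r * i)%N) m x y = defect P (m, r * m)%N x y.
Proof.
move=> Pneg; rewrite /curve_defect /defect; congr (_ - _).
apply: eq_bigr => i _ /=; have im : (i <= m)%N by rewrite -ltnS.
have rim : (r * i < (r * m).+1)%N by rewrite ltnS leq_mul2l im orbT.
rewrite (bigD1 (Ordinal rim)) //= big1 ?addr0 ?mulnBr // => j jri.
have [lt|ge] := ltnP j (r * i); first by rewrite Pneg // mul0r.
have gt : (r * i < j)%N by rewrite ltn_neqAle eq_sym ge andbT; exact: jri.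
rewrite [P (m - i, r * m - j)%N]Pneg ?mulr0 //= mulnBr; have := ltn_ord j; lia.
Qed.

(** The coefficients of L(c t^q). *)
Definition dilate q c L i (x : A) : A :=
  if (q %| i)%N then (c ^ (i %/ q))%:R * L (i %/ q)%N x else 0.

Lemma curve_defect_dilate q c L i x y : (0 < q)%N ->
  curve_defect (dilate q c L) i x y =
    if (q %| i)%N then (c ^ (i %/ q))%:R * curve_defect L (i %/ q) x y else 0.
Proof.
move=> q0; rewrite /curve_defect /dilate; case: ifP => [/dvdnP[m ->]|qi]; last first.
  rewrite big1 ?subr0 // => j _; case: ifP => qj; last by rewrite mul0r.
  by rewrite dvdn_subl ?qi ?mulr0 // -ltnS.
rewrite mulnK // mulrBr; congr (_ - _).
rewrite big_distrr /=.
rewrite (bigID (fun j : 'I_(m * q).+1 => (q %| j)%N)) /= [X in _ + X]big1 ?addr0;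
  last by move=> j /negPf->; rewrite mul0r.
have lt (j : 'I_m.+1) : (j * q < (m * q).+1)%N.
  by rewrite ltnS leq_mul2r -ltnS ltn_ord orbT.
rewrite (reindex_onto (fun j : 'I_m.+1 => Ordinal (lt j))
    (fun i => inord (i %/ q))) /=; last first.
  move=> j qj; apply: val_inj; rewrite /= inordK ?divnK //.
  by rewrite ltnS leq_divLR // -ltnS ltn_ord.
apply: eq_big => [j|j _]; first by rewrite dvdn_mull // mulnK // inord_val eqxx.
rewrite dvdn_mull // -mulnBl dvdn_mull // !mulnK // mulrACA -natrM -expnD.
by rewrite subnKC // -ltnS.
Qed.

End Curves.

(** * Binomial coefficients and powers modulo p *)

Section Arithmetic.

Local Open Scope nat_scope.

(** Compare the coefficients of X^(p^e) in (1 + X)^(p^e q) and in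
    (1 + X^(p^e))^q, which agree over F_p by Frobenius. *)
Lemma bin_prime_power_mod p e q : prime p -> 'C(p ^ e * q, p ^ e) = q %[mod p].
Proof.
move=> hp; set P := p ^ e.
have P0 : 0 < P by rewrite expn_gt0 prime_gt0.
have Pnat : [pchar {poly 'F_p}]%R.-nat P.
  by rewrite pnatX pnatE // pchar_poly pchar_Fp.
have coef_binomial m r l : 0 < m ->
    ((((1 + 'X^m) ^+ r : {poly 'F_p})`_(m * l)) = 'C(r, l)%:R)%R.
  move=> m0; rewrite exprDn coef_sum.
  under eq_bigr => i _ do
    rewrite expr1n mul1r -exprM coefMn coefXn eqn_pmul2l //.
  have [lr|rl] := ltnP l r.+1.
    rewrite (bigD1 (Ordinal lr)) //= eqxx big1 ?addr0 // => i /negPf il.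
    by rewrite eq_sym -val_eqE /= in il *; rewrite il mul0rn.
  rewrite bin_small // big1 // => i _.
  by rewrite gtn_eqF ?mul0rn // (leq_trans (ltn_ord i)).
have := coef_binomial 1 (P * q) P isT.
rewrite mul1n exprM exprDn_pchar // !expr1n -exprM mul1n => e1.
have := coef_binomial P q 1 P0.
rewrite muln1 bin1 e1 => /(congr1 val) /=.
by rewrite !val_Fp_nat.
Qed.

(** Raising to the power p^e is the identity modulo p, so c need only
    represent - 1 / b. *)
Lemma exists_prime_power_root p e b : prime p -> ~~ (p %| b) ->
  exists c, p %| (c ^ (p ^ e) * b).+1.
Proof.
move=> hp pb; pose u : 'F_p := (- b%:R^-1)%R; exists u.
have fermat m : m ^ (p ^ e) = m %[mod p].
  by elim: e => [|e IHe]; rewrite ?expn1 // expnS mulnC expnM fermat_little.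
have uE : ((u ^ (p ^ e))%N%:R = u :> 'F_p)%R.
  by rewrite -(Fp_nat_mod hp) fermat (Fp_nat_mod hp) natr_Zp.
have chp := pchar_Fp hp.
rewrite (dvdn_pcharf chp) -natr1 natrM uE.
by rewrite mulNr mulVf ?addNr // -(dvdn_pcharf chp).
Qed.

End Arithmetic.

(** * Extension of Hasse-Schmidt derivations *)

Section Extension.

Local Open Scope ring_scope.

Variables (k : comNzRingType) (A : comPzRingType) (rho : {rmorphism k -> A}).

(** L consists of the components, on the ray j = r i, of the factor of D(s + u)
    supported in j >= r i. It transports the defect of D from degree
    a (r + 1) down to degree a. *)
Lemma ray_curve (D : nat -> A -> A) a r :
    (forall i, klinear rho (D i)) -> D 0%N = id ->
    (forall i, (i < a * r.+1)%N -> forall x y, curve_defect D i x y = 0) ->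
  exists L : nat -> A -> A,
    [/\ forall i, klinear rho (L i), L 0%N = id,
        forall i, (i < a)%N -> forall x y, curve_defect L i x y = 0 &
        forall x y, curve_defect L a x y =
          'C(a * r.+1, a)%:R * curve_defect D (a * r.+1) x y].
Proof.
move=> Dl D0 LD; pose neg (v : nat * nat) := (v.2 < r * v.1)%N.
have [] := @factorization_defect _ _ rho neg _ _ (taylor D) (a * r.+1).
- by move=> u v; rewrite /neg /= mulnDr; lia.
- by move=> u v; rewrite /neg /= mulnDr; lia.
- by move=> v; apply: klinearZ.
- by apply: funext => x; rewrite /taylor D0 mul1r.
- by rewrite /neg muln0.
- by move=> v vd x y; rewrite defect_taylor LD // mulr0.
move=> P [Pl P0 Pneg LP Pd]; exists (fun i => P (i, r * i)%N).
have deg i : (i + r * i = i * r.+1)%N by rewrite mulnS mulnC.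
split=> //; first by rewrite muln0.
- move=> i ia x y; rewrite curve_defect_ray //; apply: LP.
  by rewrite /= deg ltn_pmul2r.
move=> x y; rewrite curve_defect_ray // Pd ?deg //= /neg ?ltnn //.
by rewrite defect_taylor /= deg.
Qed.

(** The extension is D(t) o L(c t^q), where c cancels the defect in degree
    p^e q. *)
Lemma exists_extension p e q (D : nat -> A -> A) :
    prime p -> p%:R = 0 :> A -> (1 < q)%N -> ~~ (p %| q)%N ->
    (forall i, klinear rho (D i)) -> D 0%N = id ->
    (forall i, (i < p ^ e * q)%N -> forall x y, curve_defect D i x y = 0) ->
  exists E : nat -> A -> A,
    [/\ forall i, klinear rho (E i), E 0%N = id, E 1%N =1 D 1%N &
        forall i, (i <= p ^ e * q)%N -> forall x y, curve_defect E i x y = 0].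
Proof.
move=> hp pA q1 pq Dl D0 LD; have q0 := ltnW q1.
have [L [Ll L0 LL Ltop]] : exists L : nat -> A -> A,
    [/\ forall i, klinear rho (L i), L 0%N = id,
        forall i, (i < p ^ e)%N -> forall x y, curve_defect L i x y = 0 &
        forall x y, curve_defect L (p ^ e) x y =
          'C(p ^ e * q, p ^ e)%:R * curve_defect D (p ^ e * q) x y].
  by move: LD; rewrite -(prednK q0); apply: ray_curve.
have pB : ~~ (p %| 'C(p ^ e * q, p ^ e))%N.
  by rewrite /dvdn bin_prime_power_mod.
have [c cB] := exists_prime_power_root e hp pB.
pose M := dilate q c L.
have Ml i : klinear rho (M i).
  rewrite /M /dilate; case: (q %| i)%N; last exact: klinear0.
  exact: klinearZ.
have M0 : M 0%N = id.
  by apply: funext => x; rewrite /M /dilate dvdn0 div0n L0 mul1r.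
have LM i : (i < p ^ e * q)%N -> forall x y, curve_defect M i x y = 0.
  move=> iq x y; rewrite curve_defect_dilate //; case: ifP => // /dvdnP[m im].
  by move: iq; rewrite im mulnK // ltn_pmul2r // => mP; rewrite LL ?mulr0.
exists (fun m z => \sum_(i < m.+1) D i (M (m - i)%N z)); split.
- move=> i; have := @klinear_conv _ _ rho (i, 0)%N (fun a b x => D a.1 (M b.1 x)).
  rewrite /conv /=; under eq_fun => x do under eq_bigr => j _ do rewrite big_ord1.
  by apply=> a b; apply: klinear_comp.
- by apply: funext => x; rewrite big_ord1 M0 D0.
- move=> x; rewrite big_ord_recl big_ord1 /= D0 M0 /M /dilate.
  by rewrite dvdn1 gtn_eqF // add0r.
move=> i iq x y; rewrite (@curve_defect_comp _ _ rho) //; last first.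
- by move=> m mi; apply: LM; apply: leq_trans iq.
- by move=> m mi; apply: LD; apply: leq_trans iq.
move: iq; rewrite leq_eqVlt => /orP[/eqP->|iq]; last by rewrite LD ?LM ?addr0.
rewrite curve_defect_dilate // dvdn_mull // mulnK // Ltop mulrA -natrM.
rewrite -{1}[curve_defect _ _ _ _]mul1r -mulrDl [1 + _]addrC natr1.
by case/dvdnP: cB => m ->; rewrite natrM pA mulr0 mul0r.
Qed.

Lemma sum_antidiagonal m n (f : nat -> nat -> A) : (n <= m)%N ->
  \sum_(i < m.+1) \sum_(j < m.+1 | (i + j == n)%N) f i j =
  \sum_(i < n.+1) f i (n - i)%N.
Proof.
move=> nm; rewrite (big_ord_widen m.+1 (fun i => f i (n - i)%N)) // [RHS]big_mkcond.
apply: eq_bigr => i _ /=; rewrite ltnS.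
have [ni|ni] := leqP i n; last by rewrite big1 // => j /eqP; lia.
have nim : (n - i < m.+1)%N by lia.
rewrite (big_pred1 (Ordinal nim)) // => j /=.
by rewrite -val_eqE /=; apply/eqP/eqP; lia.
Qed.

Lemma curve_of_HS m D : HS rho m D ->
  exists F : nat -> A -> A,
    [/\ forall i, klinear rho (F i), F 0%N = id,
        forall i : 'I_m.+1, F i = D i &
        forall i, (i <= m)%N -> forall x y, curve_defect F i x y = 0].
Proof.
move=> [Dl D0 LD].
(* inord is meaningful only up to m, so the series is cut off beyond. *)
pose F i := if (i <= m)%N then D (inord i) else fun _ => 0.
have FD (i : 'I_m.+1) : F i = D i by rewrite /F -ltnS ltn_ord inord_val.
exists F; split=> //.
- by move=> i; rewrite /F; case: ifP => _ //; apply: klinear0.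
- by rewrite -D0 -FD.
move=> i im x y.
rewrite /curve_defect -(sum_antidiagonal (fun j l => F j x * F l y) im).
rewrite {1}/F im LD inordK //; apply/eqP; rewrite subr_eq0; apply/eqP.
by apply: eq_bigr => j _; apply: eq_bigr => l _; rewrite !FD.
Qed.

Lemma HS_of_curve m (F : nat -> A -> A) :
    (forall i, klinear rho (F i)) -> F 0%N = id ->
    (forall i, (i <= m)%N -> forall x y, curve_defect F i x y = 0) ->
  HS rho m (fun i => F i).
Proof.
move=> Fl F0 LF; split=> // n x y.
have nm : (n <= m)%N by rewrite -ltnS.
have /eqP := LF n nm x y; rewrite subr_eq0 => /eqP->.
by rewrite (sum_antidiagonal (fun i j => F i x * F j y) nm).
Qed.

End Extension.

Lemma prime_power_decomposition p n : prime p -> 1 < n ->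
    ~ (exists e, n = p ^ e) ->
  exists e q, [/\ n = p ^ e * q, 1 < q & ~~ (p %| q)].
Proof.
move=> hp hn hnp; have [q pq nq] := pfactor_coprime hp (ltnW hn).
exists (logn p n), q; split; first by rewrite mulnC.
  case: q pq nq => [|[|//]] _ nq; first by rewrite nq in hn.
  by case: hnp; exists (logn p n); rewrite {1}nq mul1n.
by rewrite -prime_coprime.
Qed.

Theorem theorem4p1 (p : nat) (hp : prime p)
    (k : comNzRingType) (hk : p \in [pchar k]%R)
    (A : comPzRingType) (rho : {rmorphism k -> A})
    (n : nat) (hn : 1 < n) (hnp : ~ exists e : nat, n = p ^ e) :
  IDer rho (n - 1) = IDer rho n.
Proof.
have n1 : (n - 1).+1 = n by lia.
apply/seteqP; split=> d [dDer [D HD D1]]; split=> //.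
  have [F [Fl F0 FD LF]] := curve_of_HS HD.
  have [e [q [nE q1 pq]]] := prime_power_decomposition hp hn hnp.
  have pA : (p%:R = 0 :> A)%R.
    by rewrite -(rmorph_nat rho) (pcharf0 hk) rmorph0.
  have LFn i : i < p ^ e * q -> forall x y, curve_defect F i x y = 0%R.
    by rewrite -nE -n1 ltnS; apply: LF.
  have [E [El E0 E1 LE]] := exists_extension hp pA q1 pq Fl F0 LFn.
  exists (fun i => E i); first by apply: HS_of_curve => //; rewrite nE.
  rewrite -D1 -FD !inordK; [exact: funext E1| lia | lia].
have [F [Fl F0 FD LF]] := curve_of_HS HD.
exists (fun i => F i).
  by apply: HS_of_curve => // i i1; apply: LF; lia.
by rewrite -D1 -FD !inordK //; lia.
Qed.
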